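(* Assume that the transition kernel $Q$ only charges a finite set $\{x_1,\dots,x_M\}\subset E$, and fix $k\in\{1,\dots,M\}$; write $t_k^\star=t^\star(x_k)$. Let $n\geq 1$. The process $M_n(x_k,\cdot)$ defined by $$\forall\, 0\leq t<t_k^\star,\quad M_n(x_k,t)=N_n(x_k,t)-\int_0^t\lambda(x_k,s)\,Y_n(x_k,s)\,ds$$ is a continuous-time martingale under $\mathbf{P}_{\nu_0}$ with respect to the filtration $(\widetilde{\mathcal F}_t^n)_{0\leq t<t_k^\star}$, where $$\forall\, 0\leq t<t_k^\star,\quad \widetilde{\mathcal F}_t^n=\mathcal G_n\vee\bigvee_{i=0}^{n-1}\mathcal F_t^{i+1}.$$
   Context: Setting. $(\mathcal E,d)$ is a separable metric space and $E\subset\mathcal E$ is open, with Borel $\sigma$-field $\mathcal B(E)$. Let $Q$ be a Markov transition kernel on $(E,\mathcal B(E))$, $\lambda:E\times\mathbf R_+\to\mathbf R_+$ (the jump rate) and $t^\star:E\to\,]0,+\infty]$ (the deterministic censorship). On a probability space $(\Omega,\mathcal A,\mathbf P_{\nu_0})$, $(Z_n)_{n\ge0}$ is a Markov chain with kernel $Q$ and initial distribution $\nu_0$, written $Z_n=\psi(Z_{n-1},\varepsilon_{n-1})$ for $n\ge1$, with $\psi$ measurable and $(\varepsilon_n)_{n\ge0}$ i.i.d. The interarrival times satisfy $S_0=0$ and, for $n\ge1$, $S_n=\varphi(Z_{n-1},\delta_{n-1})$ with $\varphi$ measurable and $(\delta_n)_{n\ge0}$ i.i.d., independent of $(\varepsilon_n)_{n\ge0}$;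 both sequences are independent of $Z_0$. The law of $S_n$, $n\geq1$, is given for $t\ge0$ by $$\mathbf P_{\nu_0}(S_n>t\mid\{Z_i:i\ge0\},S_0,\dots,S_{n-1})=\mathbf P_{\nu_0}(S_n>t\mid Z_{n-1})=\exp\Big(-\int_0^t\lambda(Z_{n-1},s)\,ds\Big)\mathbf 1_{\{0\le t<t^\star(Z_{n-1})\}}.$$ Notation. $\mathcal G_n=\sigma(Z_0,\dots,Z_{n-1})$. For each integer $i\ge0$, $N^{i+1}(t)=\mathbf 1_{\{S_{i+1}\le t\}}$ and $(\mathcal F_t^{i+1})_{t\ge0}$ is the filtration generated by $N^{i+1}$. For $t\ge0$, $$N_n(x_k,t)=\sum_{i=0}^{n-1}\mathbf 1_{\{S_{i+1}\le t\}}\mathbf 1_{\{Z_i=x_k\}},\qquad Y_n(x_k,t)=\sum_{i=0}^{n-1}\mathbf 1_{\{S_{i+1}\ge t\}}\mathbf 1_{\{Z_i=x_k\}}.$$ *)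

(* Defs.v *)
From HB Require Import structures.
From mathcomp Require Import all_boot all_order all_algebra finmap.
From mathcomp Require Import all_classical all_reals all_analysis measurable_realfun.

Set Implicit Arguments.
Unset Strict Implicit.
Unset Printing Implicit Defensive.

Import Order.TTheory GRing.Theory Num.Theory.
Import numFieldNormedType.Exports.

Local Open Scope classical_set_scope.
Local Open Scope ring_scope.

Definition separable (T : topologicalType) : Prop :=
  exists2 D : set T, countable D & dense D.

(* [measurableType] requires a pointed carrier, and the subtype [set_type E] of
   a set [E] is not pointed: [borelType t0] is [T] with its Borel sigma-algebra,
   pointed at [t0], which plays no other role. *)
Definition borelType (T : topologicalType) (t0 : T) : Type := T.

Section borel_instance.
Variables (T : topologicalType) (t0 : T).

Let borelC (A : set T) : <<s @open T >> A -> <<s @open T >> (~` A).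
Proof. by move=> sA; rewrite -setTD; exact: sigma_algebraCD. Qed.

HB.instance Definition _ := Topological.on (borelType t0).
HB.instance Definition _ := isPointed.Build (borelType t0) t0.
HB.instance Definition _ := @isMeasurable.Build (sigma_display (@open T))
  (borelType t0) <<s @open T >> (@sigma_algebra0 _ setT (@open T)) borelC
  (@sigma_algebra_bigcup _ setT (@open T)).

End borel_instance.

Section probability_notions.
Context d (Omega : measurableType d) (R : realType) (P : probability Omega R).

Definition sigma_of (I : Type) d' (T : measurableType d') (J : set I)
    (X : I -> Omega -> T) : set (set Omega) :=
  <<s \bigcup_(i in J) preimage_set_system setT (X i) measurable >>.

Definition independent (F G : set (set Omega)) : Prop :=
  forall A B, F A -> G B -> P (A `&` B) = (P A * P B)%E.

Definition iid d' (T : measurableType d') (X : nat -> {RV P >-> T}) : Prop :=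
  (forall n (A : set T), measurable A ->
     distribution P (X n) A = distribution P (X 0%N) A) /\
  (forall (J : {fset nat}) (A : nat -> set T), (forall j, measurable (A j)) ->
     P (\bigcap_(j in [set` J]) (X j @^-1` A j)) =
     (\prod_(j <- J) P (X j @^-1` A j))%E).

(* [Y] is a version of E[X | G]; [G] is meant to be a sub-sigma-algebra and [X]
   to be integrable. *)
Definition cond_expectation (G : set (set Omega)) (X Y : Omega -> R) : Prop :=
  [/\ preimage_set_system setT Y measurable `<=` G,
      P.-integrable setT (EFin \o Y) &
      forall A, G A ->
        (\int[P]_(w in A) (Y w)%:E = \int[P]_(w in A) (X w)%:E)%E].

Definition cond_probability (G : set (set Omega)) (A : set Omega)
    (Y : Omega -> R) : Prop :=
  cond_expectation G (\1_A) Y.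

Definition filtration (T : set R) (F : R -> set (set Omega)) : Prop :=
  [/\ forall t, T t -> sigma_algebra setT (F t),
      forall t, T t -> F t `<=` measurable &
      forall s t, T s -> T t -> s <= t -> F s `<=` F t].

Definition martingale (T : set R) (F : R -> set (set Omega))
    (X : R -> Omega -> R) : Prop :=
  [/\ filtration T F,
      forall t, T t -> preimage_set_system setT (X t) measurable `<=` F t,
      forall t, T t -> P.-integrable setT (EFin \o X t) &
      forall s t, T s -> T t -> s <= t -> cond_expectation (F s) (X t) (X s)].

Definition markov_chain d' (E : measurableType d') (Q : R.-pker E ~> E)
    (nu0 : probability E R) (Z : nat -> {RV P >-> E}) : Prop :=
  (forall B : set E, measurable B -> distribution P (Z 0%N) B = nu0 B) /\
  (forall n (B : set E), measurable B ->
     cond_probability (sigma_of `I_n.+1 Z) (Z n.+1 @^-1` B)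
       (fun w => fine (Q (Z n w) B))).

End probability_notions.

(* The integral and the exponential are extended real valued, so that the
   survival function vanishes wherever the cumulative rate is infinite. *)
Definition survival (R : realType) (E : Type) (lambda : E -> R -> R)
    (tstar : E -> \bar R) (z : E) (t : R) : R :=
  fine (expeR (- \int[lebesgue_measure]_(s in `[0%R, t]) (lambda z s)%:E)%E) *
  (t%:E < tstar z)%E%:R.

Section counting.
Context d (Omega : measurableType d) (R : realType) (E : Type).
Variables (Z : nat -> Omega -> E) (S : nat -> Omega -> \bar R).

(* [jump i] is the process N^{i+1} *)
Definition jump (i : nat) (t : R) : Omega -> R :=
  \1_[set w | (S i.+1 w <= t%:E)%E].

Definition jump_filtration (i : nat) (t : R) : set (set Omega) :=
  sigma_of [set s | 0 <= s <= t] (jump i).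

Definition count_jumps (n : nat) (x : E) (t : R) (w : Omega) : R :=
  \sum_(i < n) \1_[set w | (S i.+1 w <= t%:E)%E] w * \1_[set w | Z i w = x] w.

Definition at_risk (n : nat) (x : E) (t : R) (w : Omega) : R :=
  \sum_(i < n) \1_[set w | (t%:E <= S i.+1 w)%E] w * \1_[set w | Z i w = x] w.

(* [lambda x] need not be locally integrable: the real-valued integral is 0 when
   the cumulative rate is infinite. *)
Definition compensated (lambda : E -> R -> R) (n : nat) (x : E) (t : R)
    (w : Omega) : R :=
  count_jumps n x t w -
  \int[lebesgue_measure]_(s in `[0, t]) (lambda x s * at_risk n x s w).

End counting.

Definition enlarged_filtration d (Omega : measurableType d) (R : realType) d'
    (E : measurableType d') (Z : nat -> Omega -> E) (S : nat -> Omega -> \bar R)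
    (n : nat) (t : R) : set (set Omega) :=
  <<s sigma_of `I_n Z `|` \bigcup_(i in `I_n) jump_filtration S i t >>.

(* Main.v *)
Require Import Defs.
From HB Require Import structures.
From mathcomp Require Import all_boot all_order all_algebra finmap.
From mathcomp Require Import all_classical all_reals all_analysis measurable_realfun.
From mathcomp Require Import ring lra.

Set Implicit Arguments.
Unset Strict Implicit.
Unset Printing Implicit Defensive.

Import Order.TTheory GRing.Theory Num.Theory.
Import numFieldNormedType.Exports.

Local Open Scope classical_set_scope.
Local Open Scope ring_scope.

(** Write x for the fixed state, [T = S i.+1], [X = visit Z x i] for the event
    that the i-th state is x, f for the rate at x, and [decay f v] for
    exp(-(integral of f over [0, v])).  The process is a sum over i < n of
    terms living on X, so the martingale property is a statement about a single
    interarrival time: for A in the enlarged filtration at time s and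
    [D = A `&` X],
      E[ integral of f(u) 1(u <= T) over ]s, t] ; D ] = P(D, s < T <= t).

    Conditionally on the whole chain the S's are independent, so the information
    carried by the other interarrival times does not change the law of T.
    [survival_ratio] expresses this without conditional probabilities: for all
    v, v' one has e(v') P(.., v < T) = e(v) P(.., v' < T), where e is the
    survival function at x and the dots stand for X, an event of the past and a
    constraint on later interarrival times.  The later times are removed one at
    a time, from the last one down, by their conditional law.  A monotone class
    argument on events [B `&` {u j < S j.+1 for all j < n}] transfers the
    proportionality to every A known at time s, as long as v >= s
    ([filtration_survival_ratio]): being in A constrains T only up to time s.

    By Tonelli the left-hand side above is the integral over ]s, t] of
    f(u) P(D, u < T), and by proportionality P(D, u < T) = c decay(u).  What
    remains is the identity
      integral of f decay over ]s, t] = decay(s) - decay(t)   ([integral_decay]).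
    As f is only measurable, decay need not be differentiable everywhere; the
    identity comes instead from a comparison of increments that is quadratic in
    the increment of the cumulative rate ([quadratic_increments_cst]).

    The rate may also have an infinite integral before the censorship time.  At
    the first explosion point r two things could happen: the cumulative rate
    tends to infinity at r, and the identity is obtained in the limit; or it
    jumps from a finite value at r to infinity right after r.  The second
    behaviour is incompatible with the right continuity of v |-> P(X, v < T),
    unless P(X) = 0.  When the rate is not integrable the compensator is finite
    only almost surely; its finite part is used instead, which changes neither
    measurability nor integrals. *)

(** * The exponential of minus a cumulative rate *)

(** Cutting [s, t] at a point where L takes the middle value of its range halves
    the bound on the increment of Phi, since 2 (l/2)^2 = l^2/2.  Iterating makes
    the increment of Phi over [s, t] arbitrarily small.  This replaces the
    fundamental theorem of calculus for absolutely continuous functions. *)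
Lemma quadratic_increments_cst (R : realType) (L Phi : R -> R) (s t : R) :
  s <= t -> {within `[s, t], continuous L} ->
  (forall a b, s <= a -> a <= b -> b <= t -> L a <= L b) ->
  (forall a b, s <= a -> a <= b -> b <= t ->
     `|Phi b - Phi a| <= (L b - L a) ^+ 2) ->
  Phi t = Phi s.
Proof.
move=> st cL Lmono Phi_le.
have halve m : forall a b, s <= a -> a <= b -> b <= t ->
    `|Phi b - Phi a| <= (L b - L a) ^+ 2 / 2 ^+ m.
  elim: m => [|m ih] a b sa ab bt; first by rewrite expr0 divr1 Phi_le.
  have Lab := Lmono _ _ sa ab bt.
  have cLab : {within `[a, b], continuous L}.
    apply: continuous_subspaceW cL => r /=; rewrite !in_itv /= => /andP[ar rb].
    by rewrite (le_trans sa ar) (le_trans rb bt).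
  have [|c] := IVT (v := (L a + L b) / 2) ab cLab.
    by rewrite (min_idPl Lab) (max_idPr Lab); apply/andP; split; lra.
  rewrite in_itv /= => /andP[ac cb] Lc.
  have h1 := ih _ _ sa ac (le_trans cb bt).
  have h2 := ih _ _ (le_trans sa ac) cb bt.
  have -> : Phi b - Phi a = (Phi b - Phi c) + (Phi c - Phi a) by lra.
  apply: (le_trans (ler_normD _ _)).
  apply: (le_trans (lerD h2 h1)).
  have m2 : (2 ^+ m : R) != 0 by rewrite expf_neq0.
  rewrite Lc (exprS 2 m) le_eqVlt; apply/orP; left; apply/eqP; move: (2 ^+ m) m2 => p p0.
  by field.
apply/eqP; rewrite -subr_eq0 -normr_eq0; apply/eqP/le_anti.
rewrite normr_ge0 andbT.
apply/ler_addgt0Pr => e e0; rewrite add0r.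
set K := (L t - L s) ^+ 2.
have K0 : 0 <= K by exact: sqr_ge0.
pose m := Num.truncn (K / e).
apply: (le_trans (halve m.+1 s t _ _ _)) => //.
rewrite -/K ler_pdivrMr ?exprn_gt0// mulrC -ler_pdivrMr//.
have := truncnS_gt (K / e); rewrite -/m => /ltW /le_trans; apply.
by rewrite -natrX ler_nat; exact: (ltnW (ltn_expl _ _)).
Qed.

Section cumulative_rate.
Variables (R : realType) (f : R -> R).
Hypotheses (f0 : forall s, 0 <= f s) (mf : measurable_fun setT f).

Notation mu := (@lebesgue_measure R).

Definition cumul (v : R) : \bar R := (\int[mu]_(s in `[0%R, v]) (f s)%:E)%E.

(** The real number exp(-(cumul v)), equal to 0 where [cumul v] is infinite. *)
Definition decay (v : R) : R := fine (expeR (- cumul v)%E).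

Let mfE D : measurable_fun D (EFin \o f).
Proof. by apply/measurable_EFinP; exact: measurable_funTS. Qed.

Lemma cumul_ge0 v : (0 <= cumul v)%E.
Proof. by apply: integral_ge0 => s _; rewrite lee_fin. Qed.

Lemma le_cumul u v : u <= v -> (cumul u <= cumul v)%E.
Proof.
move=> uv; apply: ge0_subset_integral => //=; first exact: mfE.
- by move=> s _; rewrite lee_fin.
- by apply: subset_itvl; rewrite bnd_simp.
Qed.

Lemma decayE v : (cumul v < +oo)%E -> decay v = expR (- fine (cumul v)).
Proof.
by rewrite -ge0_fin_numE ?cumul_ge0// => /fineK h; rewrite /decay -h.
Qed.

Lemma decay_eq0 v : (decay v == 0) = (cumul v == +oo%E).
Proof.
rewrite /decay; have := cumul_ge0 v; case: (cumul v) => [r| |]//= _.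
- by rewrite gt_eqF// expR_gt0.
- by rewrite !eqxx.
Qed.

Lemma decay_ge0 v : 0 <= decay v.
Proof. by rewrite fine_ge0// expeR_ge0. Qed.

Lemma le_decay : {homo decay : u v /~ v <= u}.
Proof.
move=> u v uv; have := le_cumul uv; rewrite /decay.
have := cumul_ge0 u; have := cumul_ge0 v.
case: (cumul u) (cumul v) => [a| |] [b| |]//=; rewrite ?expR_ge0// => _ _.
by rewrite lee_fin ler_expR lerN2.
Qed.

Lemma measurable_decay D : measurable D -> measurable_fun D decay.
Proof. by move=> mD; apply: nonincreasing_measurable => //; exact: le_decay. Qed.

Lemma decay_neg v : v < 0 -> decay v = 1.
Proof.
by move=> v0; rewrite /decay /cumul set_itv_ge ?integral_set0 ?oppe0 ?expeR0//;
  rewrite bnd_simp -ltNge.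
Qed.

Lemma decay_le1 v : decay v <= 1.
Proof.
rewrite /decay; have := cumul_ge0 v; case: (cumul v) => [r| |]//=.
by rewrite lee_fin => r0; rewrite -expR0 ler_expR oppr_le0.
Qed.

(** With d the increment of the cumulative rate over ]a, b], both the integral of
    f decay over ]a, b] and decay(a) - decay(b) lie between d decay(b) and
    d decay(a), and decay(a) - decay(b) <= d.  The two quantities thus differ by
    at most d^2, and [quadratic_increments_cst] applies to
    Phi(v) = integral of f decay over [0, v] + decay(v). *)
Lemma integral_decay_finite s t : 0 <= s -> s <= t -> (cumul t < +oo)%E ->
  (\int[mu]_(u in `]s, t]) (f u * decay u)%:E = (decay s - decay t)%:E)%E.
Proof.
move=> s0 st Lt.
have t0 := le_trans s0 st.
pose L v := fine (cumul v).
have intf : mu.-integrable `[0, t] (EFin \o f).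
  apply/integrableP; split; first exact: mfE.
  by under eq_integral => u _ do rewrite gee0_abs ?lee_fin//.
have dE v : v <= t -> decay v = expR (- L v).
  by move=> vt; rewrite decayE//; exact: le_lt_trans (le_cumul vt) Lt.
have intfd : mu.-integrable `[0, t] (EFin \o (fun u => f u * decay u)).
  apply: (le_integrable _ _ _ intf) => //=.
    apply/measurable_EFinP; apply: measurable_funM; first exact: measurable_funTS.
    exact: measurable_decay.
  move=> u _; rewrite lee_fin !ger0_norm ?mulr_ge0 ?decay_ge0//.
  by rewrite ler_piMr ?decay_le1.
pose Phi v := \int[mu]_(u in `[0%R, v]) (f u * decay u) + decay v.
have itvS a b : 0 <= a -> b <= t -> `]a, b]%classic `<=` (`[0, t]%classic : set R).
  move=> a0 bt u /=; rewrite !in_itv /= => /andP[au ub].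
  by rewrite (le_trans a0 (ltW au)) (le_trans ub bt).
have cumulB a b : 0 <= a -> a <= b -> b <= t ->
    \int[mu]_(u in `]a, b]) f u = L b - L a.
  move=> a0 ab bt; rewrite -(@Rintegral_itvB _ f (BLeft 0) (BRight b) a)//.
  by apply: (integrableS _ _ _ intf) => //; apply: subset_itvl; rewrite bnd_simp.
have PhiB a b : 0 <= a -> a <= b -> b <= t ->
    Phi b - Phi a = \int[mu]_(u in `]a, b]) (f u * decay u) - (decay a - decay b).
  move=> a0 ab bt.
  rewrite -(@Rintegral_itvB _ (fun u => f u * decay u) (BLeft 0) (BRight b) a)//.
    by rewrite /Phi opprD addrACA opprB.
  by apply: (integrableS _ _ _ intfd) => //; apply: subset_itvl; rewrite bnd_simp.
have Lmono a b : a <= b -> b <= t -> L a <= L b.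
  move=> ab bt; apply: fine_le; last exact: le_cumul.
  - by rewrite ge0_fin_numE ?cumul_ge0//; apply: le_lt_trans Lt; apply: le_cumul; lra.
  - by rewrite ge0_fin_numE ?cumul_ge0//; apply: le_lt_trans Lt; exact: le_cumul.
have : Phi t = Phi s.
  apply: (@quadratic_increments_cst _ L) => //.
  - have := parameterized_integral_continuous t0 intf.
    apply: continuous_subspaceW => u /=; rewrite !in_itv /= => /andP[su ut].
    by rewrite (le_trans s0 su).
  - by move=> a b _ ab bt; exact: Lmono.
  move=> a b sa ab bt.
  have a0 := le_trans s0 sa.
  have ifab : mu.-integrable `]a, b] (EFin \o f).
    by apply: (integrableS _ _ _ intf) => //; exact: itvS.
  have ifdab : mu.-integrable `]a, b] (EFin \o (fun u => f u * decay u)).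
    by apply: (integrableS _ _ _ intfd) => //; exact: itvS.
  have ifc c : mu.-integrable `]a, b] (EFin \o (fun u => f u * c)).
    have := @integrableZr _ _ R mu _ _ c _ ifab.
    by apply => //.
  have cE c : \int[mu]_(u in `]a, b]) (f u * c) = (L b - L a) * c.
    by rewrite (RintegralZr _ _ ifab)// (cumulB _ _ a0 ab bt).
  have lo : (L b - L a) * decay b <= \int[mu]_(u in `]a, b]) (f u * decay u).
    rewrite -cE.
    apply: le_Rintegral => // u /=; rewrite in_itv /= => /andP[au ub].
    by apply: ler_wpM2l => //; exact: le_decay.
  have hi : \int[mu]_(u in `]a, b]) (f u * decay u) <= (L b - L a) * decay a.
    rewrite -cE.
    apply: le_Rintegral => // u /=; rewrite in_itv /= => /andP[au ub].
    by apply: ler_wpM2l => //; apply: le_decay; exact: ltW.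
  rewrite PhiB//.
  have Lab := Lmono _ _ ab bt.
  have at_ := le_trans ab bt.
  have ea : decay a = decay b * expR (L b - L a).
    by rewrite !dE// -expRD; congr expR; lra.
  have eb : decay b = decay a * expR (- (L b - L a)).
    by rewrite !dE// -expRD; congr expR; lra.
  have ha : decay b * (1 + (L b - L a)) <= decay a.
    by rewrite ea ler_wpM2l ?decay_ge0 ?expR_ge1Dx.
  have hb : decay a * (1 + - (L b - L a)) <= decay b.
    by rewrite eb ler_wpM2l ?decay_ge0 ?expR_ge1Dx.
  have a1 := decay_le1 a.
  have b0 := decay_ge0 b.
  have d0 : 0 <= L b - L a by lra.
  move: lo hi ha hb a1 b0 d0; set x := \int[mu]_(u in _) _.
  move: (L b - L a) (decay a) (decay b) => y p q.
  move=> lo hi ha hb a1 b0 d0.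
  have : (p - q) * y <= y ^+ 2.
    rewrite expr2 ler_wpM2r//; nra.
  rewrite ler_norml; nra.
move/eqP; rewrite -subr_eq0 PhiB// subr_eq0 => /eqP <-.
rewrite /Rintegral fineK//.
by apply: integrable_fin_num => //; apply: (integrableS _ _ _ intfd) => //; exact: itvS.
Qed.

End cumulative_rate.

Section cumulative_rate_explosion.
Variables (R : realType) (f : R -> R).
Hypotheses (f0 : forall s, 0 <= f s) (mf : measurable_fun setT f).

Notation mu := (@lebesgue_measure R).

Let mfE D : measurable_fun D (EFin \o f).
Proof. by apply/measurable_EFinP; exact: measurable_funTS. Qed.

Let mfd D : measurable D -> measurable_fun D (fun u => (f u * decay f u)%:E).
Proof.
move=> mD; apply/measurable_EFinP; apply: measurable_funM.
  exact: measurable_funTS.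
exact: measurable_decay.
Qed.

Lemma bigcup_itv_left (a : itv_bound R) (s t : R) : s < t ->
  \bigcup_n [set` Interval a (BRight (t - (t - s) / n.+1%:R))] =
  [set` Interval a (BLeft t)].
Proof.
move=> st; apply/seteqP; split => u /=.
  move=> [n _] /=; rewrite !itv_boundlr => /andP[-> /=].
  rewrite !bnd_simp => /le_lt_trans; apply.
  by rewrite ltrBlDr ltrDl divr_gt0// subr_gt0.
rewrite itv_boundlr => /andP[au]; rewrite bnd_simp => ut.
have tu : 0 < t - u by rewrite subr_gt0.
exists (Num.truncn ((t - s) / (t - u))) => //=.
rewrite itv_boundlr au /= bnd_simp.
have := truncnS_gt ((t - s) / (t - u)).
rewrite ltr_pdivrMr// => /ltW; rewrite mulrC -ler_pdivrMr// => h.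
by rewrite lerBrDr addrC -lerBrDr.
Qed.

(** Monotone convergence along an explicit sequence that increases to t. *)
Lemma cvg_integral_itv_left (g : R -> \bar R) (a : itv_bound R) (s t : R) : s < t ->
  (forall D, measurable D -> measurable_fun D g) -> (forall u, 0 <= g u)%E ->
  (\int[mu]_(u in [set` Interval a (BRight (t - (t - s) / n.+1%:R)%R)]) g u)%E
    @[n --> \oo] --> (\int[mu]_(u in [set` Interval a (BLeft t)]) g u)%E.
Proof.
move=> st mg g0; rewrite -(bigcup_itv_left a st).
apply: ge0_nondecreasing_set_cvg_integral => //; last by move=> i; exact: mg.
move=> i j ij; apply/subsetPset; apply: subset_itvl; rewrite bnd_simp.
rewrite lerB// ler_pM2l ?subr_gt0// lef_pV2 ?posrE//.
by rewrite ler_nat.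
Qed.

(** The last hypothesis forbids [decay] to be positive at v and 0 right after v.
    Hence at the supremum r of the points where [decay] is positive the
    cumulative rate is infinite; it is then also the limit of its values before r,
    where [integral_decay_finite] applies.  After r everything vanishes. *)
Lemma integral_decay s t : 0 <= s -> s <= t -> 0 < decay f s ->
  (forall v, s <= v -> v < t -> 0 < decay f v ->
     exists2 u, v < u <= t & 0 < decay f u) ->
  (\int[mu]_(u in `]s, t]) (f u * decay f u)%:E =
   (decay f s - decay f t)%:E)%E.
Proof.
move=> s0 st es rc.
have [ft|] := ltP (cumul f t) +oo%E; first exact: integral_decay_finite.
rewrite leye_eq -decay_eq0// => /eqP et.
pose A := [set v | s <= v <= t /\ 0 < decay f v].
have As : A s by split => //; rewrite lexx.
have supA : has_sup A by split; [exists s|exists t => v [/andP[]]].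
pose r := sup A.
have sr : s <= r by apply: ub_le_sup => //; case: supA.
have rt : r <= t by apply: sup_le_ub; [exists s|move=> v [/andP[]]].
(* otherwise the hypothesis would give a point beyond the supremum *)
have er : decay f r = 0.
  apply/eqP/negPn/negP => er0.
  have er1 : 0 < decay f r by rewrite lt_neqAle eq_sym er0 decay_ge0.
  have rt' : r < t.
    by rewrite lt_neqAle rt andbT; apply: contraNneq er0 => ->; rewrite et.
  have [u /andP[ru ut] eu] := rc _ sr rt' er1.
  suff : u <= r by rewrite leNgt ru.
  by apply: ub_le_sup; [case: supA|split => //; rewrite ut andbT (le_trans sr)// ltW].
have sr' : s < r.
  by rewrite lt_neqAle sr andbT; apply: contraTneq es => ->; rewrite er ltxx.
have fin_before v : v < r -> (cumul f v < +oo)%E.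
  move=> vr; have [u [_ eu] vu] := sup_gt (proj1 supA) vr.
  rewrite ltey -decay_eq0//; apply: lt0r_neq0; apply: (lt_le_trans eu).
  by apply: le_decay => //; exact: ltW.
pose v (n : nat) := r - (r - s) / n.+1%:R.
have vr n : v n < r by rewrite /v ltrBlDr ltrDl divr_gt0// subr_gt0.
have sv n : s <= v n.
  rewrite /v lerBrDl -lerBrDr.
  by rewrite ler_pdivrMr// ler_peMr ?subr_ge0// ler1n.
have cumul_v : cumul f (v n) @[n --> \oo] --> +oo%E.
  suff -> : +oo%E = (\int[mu]_(u in [set` Interval (BLeft 0%R) (BLeft r)]) (f u)%:E)%E.
    by apply: cvg_integral_itv_left => // u; rewrite lee_fin.
  apply/esym/eqP; rewrite integral_itv_bndo_bndc; last exact: mfE.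
  by rewrite -[X in X == _]/(cumul f r) -decay_eq0// er.
have decay_v : decay f (v n) @[n --> \oo] --> (0 : R).
  apply/cvgr0Pnorm_lt => e e0.
  move/cvgeyPgt : cumul_v => /(_ (- ln e)); apply: filterS => n /=.
  rewrite ger0_norm ?decay_ge0// decayE ?fin_before//.
  have := fin_before _ (vr n); rewrite -ge0_fin_numE ?cumul_ge0// => /fineK <-.
  by rewrite lte_fin /= -[X in _ -> _ < X](lnK e0)// ltr_expR => h; lra.
have -> : (\int[mu]_(u in `]s, t]) (f u * decay f u)%:E =
           \int[mu]_(u in `]s, r[) (f u * decay f u)%:E)%E.
  rewrite (@itv_bndbnd_setU _ _ (BRight s) (BLeft r) (BRight t)) ?bnd_simp//.
  rewrite ge0_integral_setU//=; first last.
  - apply/disj_setPS => u /= []; rewrite !in_itv /= => /andP[_ ur] /andP[ru _].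
    by move: ur; rewrite ltNge ru.
  - by move=> u _; rewrite lee_fin mulr_ge0// decay_ge0.
  - by apply: mfd; exact: measurableU.
  rewrite [X in (_ + X)%E](_ : _ = 0%E) ?adde0//.
  apply: integral0_eq => u /=; rewrite in_itv /= => /andP[ru _].
  suff -> : decay f u = 0 by rewrite mulr0.
  by apply/le_anti; rewrite decay_ge0// andbT -er; exact: le_decay.
rewrite et subr0.
have h1 := @cvg_integral_itv_left (fun u => (f u * decay f u)%:E) (BRight s) s r sr' mfd
   (fun u => mulr_ge0 (f0 u) (decay_ge0 f u)).
have h2 : (\int[mu]_(u in [set` Interval (BRight s) (BRight (v n))])
             (f u * decay f u)%:E)%E @[n --> \oo] --> (decay f s)%:E.
  under eq_fun => n do rewrite integral_decay_finite ?fin_before//.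

  have : (decay f s - decay f (v n)) @[n --> \oo] --> decay f s - 0.
    by apply: cvgB; [exact: cvg_cst|exact: decay_v].
  rewrite subr0 => h; apply: cvg_EFin; last exact: h.
  by apply: nearW.
by apply: (cvg_unique _ h1 h2).
Qed.

End cumulative_rate_explosion.

(** * Conditional independence of the interarrival times *)

Section trace_integral.
Context d (Omega : measurableType d) (R : realType) (P : probability Omega R).

(** Only the part of the integral over D survives, since [mrestr P mD] gives mass 0
    to the complement of D. *)
Lemma integral_mrestr (D : set Omega) (mD : measurable D) (g : Omega -> \bar R) :
  measurable_fun setT g -> (forall w, 0 <= g w)%E ->
  (\int[mrestr P mD]_w g w = \int[P]_(w in D) g w)%E.
Proof.
move=> mg g0; rewrite -(setUv D) ge0_integral_setU//; last 3 first.
- exact: measurableC.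
- by rewrite setUv.
- exact/disj_setPCl.
rewrite (eq_measure_integral P); last first.
  by move=> A _ AD; rewrite /= /mrestr setIidl.
rewrite [X in (_ + X)%E](_ : _ = 0%E) ?adde0//.
rewrite (eq_measure_integral mzero) ?integral_measure_zero// => A _ AD.
by rewrite /= /mrestr (_ : A `&` D = set0) ?measure0//; apply/disjoints_subset.
Qed.

Variable G : set (set Omega).
Hypothesis mG : <<s G >> `<=` measurable.

Lemma measurable_fun_sub (d' : measure_display) (T : measurableType d')
    (g : Omega -> T) :
  measurable_fun (setT : set (g_sigma_algebraType G)) g -> measurable_fun setT g.
Proof.
by move=> mg _ B mB; apply: mG; apply: (mg measurableT B mB).
Qed.

Let mid : measurable_fun setT (id : Omega -> g_sigma_algebraType G).
Proof. by move=> _ B mB; rewrite setTI; exact: mG. Qed.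

(** The pull-out property of conditional expectations, in the form used below:
    two multiples of traces of P that agree as measures on the sigma-algebra
    generated by G have the same integral against functions measurable for it. *)
Lemma eq_trace_integral (c1 c2 : R) (D1 D2 : set Omega) :
  0 <= c1 -> 0 <= c2 -> measurable D1 -> measurable D2 ->
  (forall B, <<s G >> B -> c1%:E * P (B `&` D1) = c2%:E * P (B `&` D2))%E ->
  forall g : Omega -> \bar R,
    measurable_fun (setT : set (g_sigma_algebraType G)) g ->
    (forall w, 0 <= g w)%E ->
  (c1%:E * \int[P]_(w in D1) g w = c2%:E * \int[P]_(w in D2) g w)%E.
Proof.
move=> c10 c20 mD1 mD2 c12 g mg g0.
have scaled (c : {nonneg R}) D (mD : measurable D) :
    (c%:num%:E * \int[P]_(w in D) g w =
     \int[mscale c (pushforward (mrestr P mD)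
        (id : Omega -> g_sigma_algebraType G))]_w g w)%E.
  rewrite ge0_integral_mscale// ge0_integral_pushforward//.
  rewrite preimage_setT; congr (_ * _)%E; apply/esym/integral_mrestr => //.
  exact: measurable_fun_sub.
rewrite (scaled mid (NngNum c10) _ mD1) (scaled mid (NngNum c20) _ mD2).
by apply: eq_measure_integral => A mA _; exact: c12.
Qed.

End trace_integral.

Section conditional_law.
Context d (Omega : measurableType d) (R : realType) (P : probability Omega R).

Lemma cond_probabilityE (G : set (set Omega)) (A : set Omega) (Y : Omega -> R) B :
  G `<=` measurable -> measurable A -> cond_probability P G A Y -> G B ->
  (P (B `&` A) = \int[P]_(w in B) (Y w)%:E)%E.
Proof.
move=> mG mA [_ _ AY] GB; rewrite AY// integral_indic//; last exact: mG.
by rewrite setIC.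
Qed.

Variables (K : set (set Omega)) (S : nat -> {RV P >-> \bar R}).
Hypothesis mK : K `<=` measurable.

Lemma measurable_sigma_of (I : Type) d' (T : measurableType d') (J : set I)
    (X : I -> {RV P >-> T}) : sigma_of J X `<=` measurable.
Proof.
apply: smallest_sub; first exact: sigma_algebra_measurable.
by move=> _ [i Ji [B mB <-]]; exact: measurable_funP.
Qed.

(** K stands for the information carried by the whole chain, future included. *)
Definition past (i : nat) := <<s K `|` sigma_of `I_i.+1 S >>.

Lemma measurable_past i : past i `<=` measurable.
Proof.
apply: smallest_sub; first exact: sigma_algebra_measurable.
by move=> A [/mK//|/measurable_sigma_of].
Qed.

Lemma le_past i j : (i <= j)%N -> past i `<=` past j.
Proof.
move=> ij; apply: sub_smallest2r; first exact: smallest_sigma_algebra.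
move=> A [KA|SA]; first by left.
right; move: A SA; apply: sub_smallest2r; first exact: smallest_sigma_algebra.
move=> A [l /= li lA]; exists l => //=.
exact: leq_trans li _.
Qed.

Lemma past_gt i j (u : R) : (i < j)%N -> past j [set w | (u%:E < S i.+1 w)%E].
Proof.
move=> ij; apply: sub_sigma_algebra; right; apply: sub_sigma_algebra.
exists i.+1; first by rewrite /= ltnS.
exists `]u%:E, +oo[%classic; first exact: emeasurable_itv.
by apply/seteqP; split => w /=; rewrite in_itv /= andbT => // -[].
Qed.

Variable (g : nat -> R -> Omega -> R).
Hypotheses (g0 : forall j u w, 0 <= g j u w)
  (mg : forall j u,
     measurable_fun (setT : set (g_sigma_algebraType K)) (g j u))
  (S_law : forall j u,
     cond_probability P (past j) [set w | (u%:E < S j.+1 w)%E] (g j u)).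

Variables (i : nat) (X : set Omega) (gam : R -> R) (u : nat -> R).
Hypotheses (KX : <<s K >> X) (gam0 : forall v, 0 <= gam v)
  (gX : forall v w, X w -> g i v w = gam v).

Let after (m : nat) := \bigcap_(j in [set j | (i < j < m)%N])
  [set w | ((u j)%:E < S j.+1 w)%E].

Let mS j (v : R) : measurable [set w | (v%:E < S j.+1 w)%E].
Proof. exact: (@measurable_past _ _ (@past_gt j j.+1 v (leqnn _))). Qed.

Let K_past j : <<s K >> `<=` past j.
Proof.
by apply: sub_smallest2r; [exact: smallest_sigma_algebra|exact: subsetUl].
Qed.

(** Induction on m.  For the base case the conditional law of [S i.+1] gives
    P(B, X, v < S i.+1) = gam v P(B, X).  For the step, conditioning on the past
    of m replaces the constraint on [S m.+1] by the weight [g m (u m)], which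
    depends on K only and thus is measurable for the past of i;
    [eq_trace_integral] then integrates this weight against the equality of
    measures given by the induction hypothesis. *)
Lemma survival_ratio m B (v v' : R) : past i B ->
  ((gam v')%:E * P (B `&` (X `&` [set w | (v%:E < S i.+1 w)%E] `&` after m)) =
   (gam v)%:E * P (B `&` (X `&` [set w | (v'%:E < S i.+1 w)%E] `&` after m)))%E.
Proof.
have mX : measurable X by apply: (@measurable_past 0%N); exact: K_past.
elim: m B => [|m ih] B iB.
  have -> : after 0 = setT.
    by apply/seteqP; split => w //= _ j /=; rewrite ltn0 andbF.
  rewrite !setIT !setIA.
  have BX : past i (B `&` X).
    by apply: (@measurableI _ (g_sigma_algebraType _)) => //; exact: K_past.
  have law1 r : P (B `&` X `&` [set w | (r%:E < S i.+1 w)%E]) =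
      ((gam r)%:E * P (B `&` X))%E.
    rewrite (cond_probabilityE _ _ (S_law i r) BX)//; last exact: measurable_past.
    rewrite -integral_cst//; last exact: (@measurable_past i).
    by apply: eq_integral => w; rewrite inE => -[_ Xw]; rewrite gX.
  by rewrite !law1 !muleA -!EFinM mulrC.
have [im|mi] := ltnP i m; last first.
  suff -> : after m.+1 = after m by exact: ih.
  rewrite /after; congr bigcap; apply/seteqP; split => j /= /andP[ij jm].
    by have := leq_trans ij (leq_trans (ltnSE jm) mi); rewrite ltnn.
  by rewrite ij (ltn_trans jm).
have -> : after m.+1 = after m `&` [set w | ((u m)%:E < S m.+1 w)%E].
  apply/seteqP; split => w.
    move=> h; split; last by apply: h; rewrite /= im /=.
    by move=> j /= /andP[ij jm]; apply: h; rewrite /= ij /= (ltn_trans jm).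
  move=> [h hm] j /= /andP[ij]; rewrite ltnS leq_eqVlt => /orP[/eqP->//|jm].
  by apply: h; rewrite /= ij.
pose D r := X `&` [set w | (r%:E < S i.+1 w)%E] `&` after m.
have mD r : past m (B `&` D r).
  apply: (@measurableI _ (g_sigma_algebraType _)); first exact: le_past (ltnW im) _ iB.
  apply: (@measurableI _ (g_sigma_algebraType _)).
    apply: (@measurableI _ (g_sigma_algebraType _)); first exact: K_past.
    exact: past_gt.
  apply: (@fin_bigcap_measurable _ (g_sigma_algebraType _)).
    by apply: (sub_finite_set _ (finite_II m)) => j /= /andP[].
  by move=> j /= /andP[_ jm]; exact: past_gt.
have step r : P (B `&` (X `&` [set w | (r%:E < S i.+1 w)%E] `&`
      (after m `&` [set w | ((u m)%:E < S m.+1 w)%E]))) =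
    (\int[P]_(w in B `&` D r) (g m (u m) w)%:E)%E.
  rewrite -(cond_probabilityE _ _ (S_law m (u m)))//; last exact: measurable_past.
  by rewrite /D !setIA.
rewrite !step.
apply: (@eq_trace_integral _ _ _ _ (K `|` sigma_of `I_i.+1 S)) => //.
- exact: measurable_past.
- exact: (@measurable_past m).
- exact: (@measurable_past m).
- move=> B' iB'; rewrite !(setIA B' B).
  apply: ih.
  exact: (@measurableI _ (g_sigma_algebraType _)).
- apply/measurable_EFinP => _ A mA; apply: K_past.
  exact: mg.
- by move=> w; rewrite lee_fin.
Qed.

End conditional_law.

(** * Proportionality along the enlarged filtration *)

Section filtration_ratio.
Context d (Omega : measurableType d) (R : realType) (P : probability Omega R).
Context d' (E : measurableType d').
Variables (Z : nat -> {RV P >-> E}) (S : nat -> {RV P >-> \bar R}).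
Variable (surv : E -> R -> R).
Hypotheses (S_ge0 : forall j w, (0 <= S j.+1 w)%E)
  (surv_ge0 : forall z v, 0 <= surv z v)
  (msurv : forall j v,
     measurable_fun (setT : set (g_sigma_algebraType (sigma_of setT Z)))
       (fun w => surv (Z j w) v))
  (S_law : forall j v,
     cond_probability P (past (sigma_of setT Z) S j)
       [set w | (v%:E < S j.+1 w)%E] (fun w => surv (Z j w) v)).

Variables (x : E) (n : nat).
Hypothesis mx : measurable [set x].

Definition visit (i : nat) := [set w | Z i w = x].
Definition survive (i : nat) (v : R) := [set w | (v%:E < S i.+1 w)%E].

(** A pi-system that generates the enlarged filtration at time s.  Negative bounds
    [u j] are needed: they encode the absence of any constraint on [S j.+1],
    because the interarrival times are nonnegative. *)
Definition rectangle (s : R) : set (set Omega) := [set A | exists B u,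
  [/\ sigma_of `I_n Z B, forall j, u j <= s &
      A = B `&` \bigcap_(j in `I_n) survive j (u j)]].

Lemma sigma_of_visit (J : set nat) i : J i -> sigma_of J Z (visit i).
Proof.
move=> Ji; apply: sub_sigma_algebra; exists i => //; exists [set x] => //.
by apply/seteqP; split => w //= -[].
Qed.

Lemma sub_sigma_of (J J' : set nat) : J `<=` J' -> sigma_of J Z `<=` sigma_of J' Z.
Proof.
move=> JJ'; apply: sub_smallest2r; first exact: smallest_sigma_algebra.
by move=> A [i Ji iA]; exists i => //; exact: JJ'.
Qed.

Lemma measurable_survive i v : measurable (survive i v).
Proof.
by rewrite /survive -[X in measurable X]setTI; exact: measurable_lte.
Qed.

Lemma measurable_visit i : measurable (visit i).
Proof. by apply: (@measurable_sigma_of _ _ _ P _ _ _ setT Z); exact: sigma_of_visit. Qed.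

Let rectangle_measurable s : rectangle s `<=` measurable.
Proof.
move=> _ [B [u [ZB _ ->]]]; apply: measurableI; first exact: measurable_sigma_of ZB.
apply: fin_bigcap_measurable; first exact: finite_II.
by move=> j _; exact: measurable_survive.
Qed.

Let rectangle_setI s : setI_closed (rectangle s).
Proof.
move=> _ _ [B [u [ZB us ->]]] [B' [u' [ZB' us' ->]]].
exists (B `&` B'), (fun j => Num.max (u j) (u' j)); split.
- exact: (@measurableI _ (g_sigma_algebraType _)).
- by move=> j; rewrite ge_max us us'.
- rewrite setIACA -bigcapI; congr (_ `&` _); apply: eq_bigcapr => j _.
  by apply/seteqP; split => w; rewrite /survive /= EFin_max gt_max => /andP.
Qed.

Let sigma_of_rectangle s B : 0 <= s -> sigma_of `I_n Z B -> rectangle s B.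
Proof.
move=> s0 ZB; exists B, (fun _ => -1); split => //.
  by move=> _; apply: le_trans s0; rewrite lerN10.
rewrite (_ : \bigcap_(_ in _) _ = setT) ?setIT//.
apply/seteqP; split => w //= _ j _; rewrite /survive /=.
by apply: (lt_le_trans _ (S_ge0 j w)); rewrite lte_fin ltrN10.
Qed.

Let survive_rectangle s j v : 0 <= s -> v <= s -> (j < n)%N -> rectangle s (survive j v).
Proof.
move=> s0 vs jn; exists setT, (fun l => if l == j then v else -1); split.
- exact: (@measurableT _ (g_sigma_algebraType _)).
- by move=> l; case: eqP => // _; apply: le_trans s0; rewrite lerN10.
rewrite setTI; apply/seteqP; split => w.
  move=> jw l _; case: eqP => [->//|_].
  by apply: (lt_le_trans _ (S_ge0 l w)); rewrite lte_fin ltrN10.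
by move=> /(_ j jn); rewrite eqxx.
Qed.

Lemma enlarged_filtration_rectangle s : 0 <= s ->
  enlarged_filtration Z S n s `<=` <<s rectangle s >>.
Proof.
move=> s0; apply: smallest_sub; first exact: smallest_sigma_algebra.
move=> A [ZA|[j /= jn]]; first by apply: sub_sigma_algebra; exact: sigma_of_rectangle.
move: A; apply: smallest_sub; first exact: smallest_sigma_algebra.
move=> _ [r /= /andP[r0 rs] [B mB <-]].
rewrite /jump (_ : [set w | _] = ~` survive j r); last first.
  by apply/seteqP; split => w /=; rewrite /survive /= leNgt => /negP.
have mj : @measurable _ (g_sigma_algebraType (rectangle s)) (~` survive j r).
  by apply: measurableC; apply: sub_sigma_algebra; exact: survive_rectangle.
exact: (@measurable_indic _ _ R setT _ mj measurableT _ mB).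
Qed.

(** Both sides are finite measures in A, so it is enough to check rectangles.
    There the constraint u i < S i.+1 with u i <= s is absorbed by v < S i.+1 and
    by s < S i.+1; the constraints before i go to the past of i and those after i
    are the ones handled by [survival_ratio]. *)
Lemma filtration_survival_ratio i s v A : 0 <= s -> s <= v -> (i < n)%N ->
  enlarged_filtration Z S n s A ->
  ((surv x s)%:E * P (A `&` (visit i `&` survive i v)) =
   (surv x v)%:E * P (A `&` (visit i `&` survive i s)))%E.
Proof.
move=> s0 sv in_ /(enlarged_filtration_rectangle s0) sA.
have mD r : measurable (visit i `&` survive i r).
  by apply: measurableI; [exact: measurable_visit|exact: measurable_survive].
have key := @g_sigma_algebra_measure_unique _ R Omega (rectangle s)
  (@rectangle_measurable s) (fun _ => setT) _ _
  (mscale (NngNum (surv_ge0 x s)) (mrestr P (mD v)))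
  (mscale (NngNum (surv_ge0 x v)) (mrestr P (mD s)))
  (@rectangle_setI s) _ _ A sA.
apply: key.
- by move=> _; apply: sigma_of_rectangle => //; exact: (@measurableT _ (g_sigma_algebraType _)).
- by rewrite bigcup_const.
- move=> _ [B [u [ZB us ->]]].
  pose B' := B `&` \bigcap_(j in `I_i) survive j (u j).
  have pB' : past (sigma_of setT Z) S i B'.
    apply: (@measurableI _ (g_sigma_algebraType _)).
      by apply: sub_sigma_algebra; left; exact: sub_sigma_of ZB.
    apply: (@fin_bigcap_measurable _ (g_sigma_algebraType _)).
      exact: finite_II.
    by move=> j /= ji; exact: past_gt.
  have decomp r : s <= r ->
      B `&` \bigcap_(j in `I_n) survive j (u j) `&` (visit i `&` survive i r) =
      B' `&` (visit i `&` survive i r `&`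
         \bigcap_(j in [set j | (i < j < n)%N]) survive j (u j)).
    move=> sr; apply/seteqP; split => w.
      move=> [[Bw h] vw]; split.
        by split => // j /= ji; apply: h => /=; exact: ltn_trans in_.
      by split => // j /= /andP[_ jn]; exact: h.
    move=> [[Bw h1] [[vw sw] h2]]; split => //; split => // j /= jn.
    have [ji|ij|ji] := ltngtP j i; first exact: h1.
      by apply: h2; rewrite /= ij.
    rewrite ji; apply: le_lt_trans sw; rewrite lee_fin.
    exact: le_trans sr.
  rewrite -[LHS]/((surv x s)%:E * P (_ `&` (visit i `&` survive i v)))%E.
  rewrite -[RHS]/((surv x v)%:E * P (_ `&` (visit i `&` survive i s)))%E.
  rewrite !decomp//.
  apply: (@survival_ratio _ _ _ _ _ S _ _ _ msurv S_law i (visit i) (surv x)) => //.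
  + by move=> ? /measurable_sigma_of.
  + by apply: sub_sigma_algebra; exact: sigma_of_visit.
  + by move=> r w ->.
- move=> _; rewrite -[ltLHS]/((surv x s)%:E * P (_ `&` (visit i `&` survive i v)))%E.
  apply: lte_mul_pinfty; rewrite ?lee_fin//.
  by rewrite (le_lt_trans (probability_le1 _ _)) ?ltry//; apply: measurableI.
Qed.

End filtration_ratio.

(** * The compensator of one jump *)

Section compensator.
Context d (Omega : measurableType d) (R : realType) (P : probability Omega R).
Variables (f : R -> R) (T : Omega -> \bar R).
Hypotheses (f0 : forall s, 0 <= f s) (mf : measurable_fun setT f)
  (mT : measurable_fun setT T).

Notation mu := (@lebesgue_measure R).

Let mgt v : measurable [set w | (v%:E < T w)%E].
Proof. by rewrite -[X in measurable X]setTI; exact: measurable_lte. Qed.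

Definition rate_before (u : R) (w : Omega) : R :=
  f u * \1_[set w | (u%:E <= T w)%E] w.

Lemma rate_before_ge0 u w : 0 <= rate_before u w.
Proof. by rewrite mulr_ge0. Qed.

Let measurable_upto w : measurable [set u : R | (u%:E <= T w)%E].
Proof.
rewrite -[X in measurable X]setTI; exact: measurable_lee.
Qed.

Lemma measurable_rate_before w D : measurable D ->
  measurable_fun D (fun u => (rate_before u w)%:E).
Proof.
move=> mD; apply/measurable_EFinP; apply: measurable_funM.
  exact: measurable_funTS.
exact: (@measurable_indic _ _ R D [set u : R | (u%:E <= T w)%E]).
Qed.

Let ind_lt (u : R) (w : Omega) : R := \1_[set w | (u%:E < T w)%E] w.

(** The two integrands differ at the single point u = T w. *)
Lemma integral_rate_before_lt w s t :
  (\int[mu]_(u in `]s, t]) (rate_before u w)%:E =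
   \int[mu]_(u in `]s, t]) (f u * ind_lt u w)%:E)%E.
Proof.
apply: ge0_ae_eq_integral => //.
- exact: measurable_rate_before.
- apply/measurable_EFinP; apply: measurable_funM.
    exact: measurable_funTS.
  apply: (@measurable_indic _ _ R _ [set u : R | (u%:E < T w)%E]).
  rewrite -[X in measurable X]setTI.
  exact: measurable_lte.
- by move=> u _; rewrite lee_fin rate_before_ge0.
- by move=> u _; rewrite lee_fin mulr_ge0.
exists [set fine (T w)]; split => //; first exact: lebesgue_measure_set1.
move=> u /=; apply: contra_notP => uT _.
rewrite /rate_before /ind_lt !indicE; congr (_ * (nat_of_bool _)%:R)%:E.
apply/idP/idP; rewrite !inE /=; last exact: ltW.
by rewrite le_eqVlt => /orP[/eqP h|//]; rewrite -h in uT.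
Qed.

Lemma tonelli_rate_before D s t : measurable D ->
  (\int[P]_(w in D) \int[mu]_(u in `]s, t]) (rate_before u w)%:E =
   \int[mu]_(u in `]s, t]) ((f u)%:E * P (D `&` [set w | u%:E < T w])))%E.
Proof.
move=> mD.
pose A := [set p : Omega * R | D p.1 /\ `]s, t]%classic p.2 /\ (p.2%:E < T p.1)%E].
have mA : measurable A.
  rewrite (_ : A = (D `*` `]s, t]%classic) `&` [set p | (p.2%:E < T p.1)%E]); last first.
    by apply/seteqP; split => p /=; [move=> [? []]|move=> [[? ?] ?]].
  apply: measurableI; first exact: measurableX.
  rewrite -[X in measurable X]setTI; apply: measurable_lte => //.
    by apply/measurable_EFinP; exact: measurable_snd.
  by apply: measurableT_comp => //; exact: measurable_fst.
pose F (p : Omega * R) := ((f p.2)%:E * (\1_A p)%:E)%E.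
have mF : measurable_fun setT F.
  apply: emeasurable_funM; apply/measurable_EFinP.
    by apply: measurableT_comp => //; exact: measurable_snd.
  exact: measurable_indic.
have F0 p : (0 <= F p)%E by rewrite mule_ge0 ?lee_fin.
transitivity (\int[P]_w \int[mu]_u F (w, u))%E.
  rewrite integral_mkcond; apply: eq_integral => w _; rewrite /patch.
  case: ifPn => [|]; rewrite ?inE ?notin_setE => Dw; last first.
    rewrite integral0_eq// => u _; rewrite /F /= indicE memNset ?mule0//.
    by move=> [].
  rewrite integral_rate_before_lt integral_mkcond; apply: eq_integral => u _.
  rewrite /patch /F /=; case: ifPn => [|]; rewrite ?inE ?notin_setE => su; last first.
    by rewrite indicE memNset ?mule0// => -[_ []].
  rewrite EFinM; congr (_ * _%:E)%E; rewrite /ind_lt !indicE; congr (nat_of_bool _)%:R.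
  by apply/idP/idP; rewrite !inE /A /=; [|case=> _ []].
rewrite fubini_tonelli// [RHS]integral_mkcond; apply: eq_integral => u _.
rewrite /F /= ge0_integralZl_EFin//; last first.
  apply/measurable_EFinP; apply: (measurableT_comp (measurable_indic mA)).
  exact: pair2_measurable.
rewrite /patch; case: ifPn => [|]; rewrite ?inE ?notin_setE => su; last first.
  rewrite integral0_eq ?mule0// => w _; rewrite indicE memNset//.
  by move=> [_ []].
congr (_ * _)%E; rewrite -[X in P X]setIT -integral_indic//; last exact: measurableI.
apply: eq_integral => w _; rewrite !indicE; congr (nat_of_bool _)%:R%:E.
by apply/idP/idP; rewrite !inE /A /=; [case=> ? []|case].
Qed.

(** By Tonelli the double integral is that of f(u) P(D, u < T), and the last
    hypothesis makes P(D, u < T) proportional to [decay f u], so that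
    [integral_decay] applies.  Its hypothesis on [decay] holds as soon as X has
    positive probability: if [decay] vanished right after v, the event
    X, v < T would be a countable union of null events, although its
    probability is proportional to [decay f v] > 0. *)
Lemma compensator (X D : set Omega) (s t : R) :
  measurable X -> measurable D -> D `<=` X -> 0 <= s -> s <= t ->
  (forall v, 0 <= v -> v <= t -> P (X `&` [set w | (v%:E < T w)%E]) =
     ((decay f v)%:E * P (X `&` [set w | (0%:E < T w)%E]))%E) ->
  (forall v, s <= v -> v <= t ->
     ((decay f s)%:E * P (D `&` [set w | (v%:E < T w)%E]) =
      (decay f v)%:E * P (D `&` [set w | (s%:E < T w)%E]))%E) ->
  (\int[P]_(w in D) \int[mu]_(u in `]s, t]) (rate_before u w)%:E +
   P (D `&` [set w | t%:E < T w]) = P (D `&` [set w | s%:E < T w]))%E.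
Proof.
move=> mX mD DX s0 st lawX lawD.
have t0 := le_trans s0 st.
rewrite tonelli_rate_before//.
pose m v := P (D `&` [set w | (v%:E < T w)%E]).
rewrite -[X in _ = X]/(m s) -[X in (_ + X)%E]/(m t).
have mfin v : m v \is a fin_num.
  by apply: fin_num_measure; exact: measurableI.
have m_dec v : s <= v -> (m v <= m s)%E.
  move=> sv; apply: le_measure; rewrite ?inE; [exact: measurableI..|].
  by apply: setIS => w /=; apply: le_lt_trans; rewrite lee_fin.
have [ms|ms] := eqVneq (m s) 0%E.
  have mv0 v : s <= v -> m v = 0%E.
    by move=> sv; apply/eqP; rewrite -measure_le0 -ms m_dec.
  rewrite ms mv0// adde0; apply: integral0_eq => u /=.
  by rewrite in_itv /= => /andP[/ltW su _]; rewrite -/(m u) mv0// mule0.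
have XD v : (m v <= P (X `&` [set w | (v%:E < T w)%E]))%E.
  by apply: le_measure; rewrite ?inE; [exact: measurableI..|exact: setSI].
have p0 : P (X `&` [set w | (0%:E < T w)%E]) != 0%E.
  apply: contra_neq ms => p0; apply/eqP; rewrite -measure_le0.
  by apply: (le_trans (XD s)); rewrite lawX// p0 mule0.
have es : 0 < decay f s.
  rewrite lt_neqAle decay_ge0 andbT eq_sym; apply: contra_neq ms => es.
  by apply/eqP; rewrite -measure_le0; apply: (le_trans (XD s)); rewrite lawX// es mul0e.
pose c := fine (m s) / decay f s.
have mE v : s <= v -> v <= t -> m v = (c * decay f v)%:E.
  move=> sv vt; have := lawD v sv vt; rewrite -/(m v) -/(m s).
  rewrite -(fineK (mfin v)) -(fineK (mfin s)) -!EFinM => -[h].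
  congr EFin; apply: (mulfI (lt0r_neq0 es)); rewrite h /c.
  have es0 := lt0r_neq0 es.
  by field.
have c0 : 0 <= c by apply: divr_ge0; [apply: fine_ge0; exact: measure_ge0|exact: ltW].
have -> : (\int[mu]_(u in `]s, t]) ((f u)%:E * P (D `&` [set w | u%:E < T w])) =
    c%:E * \int[mu]_(u in `]s, t]) (f u * decay f u)%:E)%E.
  rewrite -ge0_integralZl_EFin//; first last.
  - apply/measurable_EFinP; apply: measurable_funM; first exact: measurable_funTS.
    exact: measurable_decay.
  - by move=> u _; rewrite lee_fin mulr_ge0// decay_ge0.
  apply: eq_integral => u; rewrite inE /= in_itv /= => /andP[/ltW su ut].
  by rewrite -/(m u) mE// -!EFinM mulrCA.
rewrite integral_decay//; last first.
  move=> v sv vt ev; apply: contrapT => nrc.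
  have zero u : v < u -> u <= t -> P (X `&` [set w | (u%:E < T w)%E]) = 0%E.
    move=> vu ut; rewrite lawX ?(le_trans s0 (le_trans sv (ltW vu)))//.
    have [eu|eu] := eqVneq (decay f u) 0; first by rewrite eu mul0e.
    exfalso; apply: nrc; exists u; first by rewrite vu.
    by rewrite lt_neqAle eq_sym eu decay_ge0.
  have v0 := le_trans s0 sv.
  have : P (X `&` [set w | (v%:E < T w)%E]) = 0%E.
    have sub : X `&` [set w | (v%:E < T w)%E] `<=`
       \bigcup_k (X `&` [set w | ((v + (t - v) / k.+1%:R)%:E < T w)%E]).
      move=> w [Xw /= vT].
      (* an intermediate r serves to pick k with (t - v) / k.+1 <= r - v *)
have [r vr rT] : exists2 r, v < r <= t & (r%:E < T w)%E.
        case: (T w) vT => [r| |]//.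
        - rewrite lte_fin => vr; exists (Num.min t ((v + r) / 2)).
            by rewrite lt_min vt ge_min lexx /= andbT; lra.
          by rewrite lte_fin gt_min; apply/orP; right; lra.
        - by move=> _; exists t; rewrite ?vt ?lexx ?ltry.
      have [vr' rt] := andP vr.
      have rv0 : 0 < r - v by rewrite subr_gt0.
      exists (Num.truncn ((t - v) / (r - v))) => //; split => //=.
      apply: le_lt_trans rT; rewrite lee_fin addrC -lerBrDr.
      rewrite ler_pdivrMr// mulrC -ler_pdivrMr//.
      exact/ltW/truncnS_gt.
    apply/eqP; rewrite -measure_le0.
    apply: (le_trans (le_measure _ _ _ sub)).
    - by rewrite inE; exact: measurableI.
    - by rewrite inE; apply: bigcup_measurable => k _; exact: measurableI.
    rewrite le_eqVlt; apply/orP; left; apply/eqP/measure_negligible.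
      by apply: bigcup_measurable => k _; exact: measurableI.
    apply: negligible_bigcup => k; apply/negligibleP; first exact: measurableI.
    apply: zero; first by rewrite ltrDl divr_gt0// subr_gt0.
    by rewrite addrC -lerBrDr ler_pdivrMr// ler_peMr ?subr_ge0 ?ler1n// ltW.
  rewrite lawX//; last exact: ltW.
  move/eqP; rewrite mule_eq0 (negbTE p0) orbF eqe.
  by rewrite gt_eqF.
rewrite !mE// -EFinM -EFinD; congr EFin; ring.
Qed.

End compensator.

(** * Measurability of the compensator with respect to a smaller sigma-algebra *)

Section stopped_rate.
Context d (Omega : measurableType d) (R : realType).
Variables (f : R -> R) (T : Omega -> \bar R).
Hypotheses (f0 : forall s, 0 <= f s) (mf : measurable_fun setT f)
  (T0 : forall w, (0 <= T w)%E).

Notation mu := (@lebesgue_measure R).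

Definition stopped (t : R) (w : Omega) : R := fine (Order.min (T w) t%:E).

Lemma le_stopped t u w : (u <= stopped t w) = (u <= t) && (u%:E <= T w)%E.
Proof.
rewrite /stopped; have := T0 w; case: (T w) => [r| |]// _.
- by rewrite -EFin_min /= le_min andbC.
- by rewrite min_r ?leey//= ?leey andbT.
Qed.

Lemma lt_stopped t u w : (u < stopped t w) = (u < t) && (u%:E < T w)%E.
Proof.
rewrite /stopped; have := T0 w; case: (T w) => [r| |]// _.
- by rewrite -EFin_min /= lt_min andbC.
- by rewrite min_r ?leey//= ?ltry andbT.
Qed.

(** Rewriting the compensator as a function of min(T, t) is what shows that it is
    known at time t. *)
Lemma integral_rate_before_stopped (a : itv_bound R) t w :
  (\int[mu]_(u in [set` Interval a (BRight t)]) (rate_before f T u w)%:E =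
   \int[mu]_(u in [set` Interval a (BRight (stopped t w))]) (f u)%:E)%E.
Proof.
rewrite integral_mkcond [RHS]integral_mkcond; apply: eq_integral => u _.
rewrite /patch !mem_setE !itv_boundlr !bnd_simp le_stopped andbA.
case: ifPn => ut; last by rewrite andFb.
rewrite /= /rate_before indicE.
have -> : (w \in [set w0 | (u%:E <= T w0)%E]) = (u%:E <= T w)%E.
  by apply/idP/idP; rewrite inE.
by case: ifP; rewrite ?mulr1 ?mulr0.
Qed.

(** The integral is monotone in r, so its superlevel sets are intervals. *)
Lemma measurable_integral_upto (a : itv_bound R) :
  measurable_fun setT
    (fun r : R => \int[mu]_(u in [set` Interval a (BRight r)]) (f u)%:E)%E.
Proof.
move=> mR; apply: (measurability _ (ErealGenCInfty.measurableE R)) => //.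
move=> _ [_ [b ->] <-]; apply: measurableI => //.
apply: is_interval_measurable => s t /=.
rewrite !in_itv/= !andbT => fs _ u /andP[su _].
rewrite in_itv /= andbT; apply: (le_trans fs); apply: ge0_subset_integral => //=.
- by apply/measurable_EFinP; exact: measurable_funTS.
- by move=> v _; rewrite lee_fin.
- by apply: subset_itvl; rewrite bnd_simp.
Qed.

Variable G : set (set Omega).

Lemma measurable_stopped t : 0 <= t ->
  (forall a, 0 <= a -> a <= t -> <<s G >> [set w | (a%:E < T w)%E]) ->
  measurable_fun (setT : set (g_sigma_algebraType G)) (stopped t).
Proof.
move=> t0 GT mO; apply: (measurability _ (RGenOInfty.measurableE R)) => //.
move=> _ [_ [a ->] <-]; rewrite setTI.
rewrite (_ : _ @^-1` _ = [set w | a < t /\ (a%:E < T w)%E]); last first.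
  by apply/seteqP; split => w /=; rewrite in_itv/= andbT lt_stopped => /andP.
have [at_|ta] := ltP a t; last first.
  rewrite (_ : [set _ | _] = set0)//.
  by apply/seteqP; split => w //= -[].
rewrite (_ : [set _ | _] = [set w | (a%:E < T w)%E]); last first.
  by apply/seteqP; split => w //= -[].
have [a0|a0] := leP 0 a; first by apply: GT => //; exact: ltW.
rewrite (_ : [set _ | _] = setT)//.
by apply/seteqP; split => w //= _; apply: lt_le_trans (T0 w); rewrite lte_fin.
Qed.

Lemma measurable_integral_rate_before (a : itv_bound R) t : 0 <= t ->
  (forall b, 0 <= b -> b <= t -> <<s G >> [set w | (b%:E < T w)%E]) ->
  measurable_fun (setT : set (g_sigma_algebraType G))
    (fun w => \int[mu]_(u in [set` Interval a (BRight t)]) (rate_before f T u w)%:E)%E.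
Proof.
move=> t0 GT; under eq_fun do rewrite integral_rate_before_stopped.
apply: (measurableT_comp (measurable_integral_upto a)).
exact: measurable_stopped.
Qed.

End stopped_rate.

(** * Finite parts *)

Section finite_part.
Context d (T : measurableType d) (R : realType) (m : {measure set T -> \bar R}).

Lemma integrable_fine (h : T -> \bar R) :
  m.-integrable setT h -> m.-integrable setT (EFin \o (fine \o h)).
Proof.
move=> ih; apply: (le_integrable _ _ _ ih) => //.
  apply/measurable_EFinP; apply: (measurableT_comp (fine_measurable measurableT)).
  exact: measurable_int ih.
by move=> w _; rewrite /=; case: (h w) => [r| |] //=; rewrite leey.
Qed.

Lemma integral_fine (h : T -> \bar R) A : measurable A ->
  m.-integrable setT h -> (\int[m]_(w in A) (fine (h w))%:E = \int[m]_(w in A) h w)%E.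
Proof.
move=> mA ih.
have iA : m.-integrable A h by exact: integrableS ih.
apply: ae_eq_integral => //.
- by apply: measurable_int; apply: (integrableS _ mA _ (integrable_fine ih)).
- exact: measurable_int iA.
have := integrable_ae mA iA; apply: filterS => w hw Aw.
by rewrite fineK ?hw.
Qed.

End finite_part.

Lemma fin_num_exchange (R : realType) (a b h k p q : \bar R) :
  a \is a fin_num -> b \is a fin_num -> h \is a fin_num -> k \is a fin_num ->
  p \is a fin_num -> q \is a fin_num ->
  (a + p = b + q -> k + q = h + p -> a - h = b - k)%E.
Proof.
move: a b h k p q => [a| |] [b| |] [h| |] [k| |] [p| |] [q| |]// _ _ _ _ _ _.
rewrite -!EFinD => -[h1] [h2]; congr EFin; lra.
Qed.

(** * The compensated counting process *)

Section marked_renewal.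
Context (R : realType) d (Omega : measurableType d) (P : probability Omega R).
Context d' (E : measurableType d').
Variables (Z : nat -> {RV P >-> E}) (S : nat -> {RV P >-> \bar R}).
Variables (lambda : E -> R -> R) (tstar : E -> \bar R).
Hypotheses (lambda_ge0 : forall z s, 0 <= s -> 0 <= lambda z s)
  (lambda_meas : forall z, measurable_fun (`[0, +oo[ : set R) (lambda z))
  (tstar_gt0 : forall z, (0 < tstar z)%E)
  (S_ge0 : forall j w, (0 <= S j.+1 w)%E)
  (S_law : forall n (t : R), 0 <= t ->
     cond_probability P <<s sigma_of setT Z `|` sigma_of `I_n.+1 S >>
       [set w | (t%:E < S n.+1 w)%E]
       (fun w => survival lambda tstar (Z n w) t) /\
     cond_probability P (sigma_of [set n] Z)
       [set w | (t%:E < S n.+1 w)%E]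
       (fun w => survival lambda tstar (Z n w) t)).

Notation mu := (@lebesgue_measure R).

(** Extending the rate by 0 to negative times makes it nonnegative and measurable
    on the whole line. *)
Definition rate (z : E) : R -> R := lambda z \_ (`[0, +oo[ : set R).

Lemma rate_ge0 z s : 0 <= rate z s.
Proof.
rewrite /rate /patch; case: ifPn => // /set_mem /=.
by rewrite in_itv /= andbT => /lambda_ge0.
Qed.

Lemma measurable_rate z : measurable_fun setT (rate z).
Proof. by apply/(measurable_restrictT _ _).1. Qed.

Lemma survivalE z v :
  survival lambda tstar z v = decay (rate z) v * (v%:E < tstar z)%E%:R.
Proof.
rewrite /survival /decay /cumul; congr (fine (expeR (- _)%E) * _).
apply: eq_integral => s; rewrite inE /= in_itv /= => /andP[s0 _].
by rewrite /rate patchE mem_set//= in_itv /= s0.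
Qed.

Lemma survival_ge0 z v : 0 <= survival lambda tstar z v.
Proof. by rewrite survivalE mulr_ge0// decay_ge0. Qed.

Lemma survival_neg z v : v < 0 -> survival lambda tstar z v = 1.
Proof.
move=> v0; rewrite survivalE decay_neg// mul1r.
by rewrite (lt_trans _ (tstar_gt0 z))// lte_fin.
Qed.

(** For negative v both the event and its conditional probability are trivial. *)
Lemma survival_law j v :
  cond_probability P (past (sigma_of setT Z) S j) (survive S j v)
    (fun w => survival lambda tstar (Z j w) v).
Proof.
have [v0|v0] := leP 0 v; first exact: (S_law j v0).1.
have sE : survive S j v = setT.
  by apply/seteqP; split => w //= _; apply: lt_le_trans (S_ge0 j w); rewrite lte_fin.
have YE : (fun w => survival lambda tstar (Z j w) v) = cst 1.
  by apply/funext => w; rewrite survival_neg.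
rewrite /cond_probability sE YE; split.
- move=> _ [B mB <-].
  have mc : measurable_fun (setT : set (g_sigma_algebraType
      (sigma_of setT Z `|` sigma_of `I_j.+1 S))) (cst (1 : R)).
    exact: measurable_cst.
  exact: (mc measurableT B mB).
- exact: finite_measure_integrable_cst.
- by move=> A _; apply: eq_integral => w _; rewrite indicT.
Qed.

Lemma measurable_survival j v :
  measurable_fun (setT : set (g_sigma_algebraType (sigma_of setT Z)))
    (fun w => survival lambda tstar (Z j w) v).
Proof.
have [v0|v0] := leP 0 v; last first.
  rewrite (_ : (fun _ => _) = cst 1); first exact: measurable_cst.
  by apply/funext => w; rewrite survival_neg.
move=> _ B mB; apply: sub_sigma_algebra.
have [_ [sub _ _]] := S_law j v0.
by apply: (@sub_sigma_of _ _ _ P _ _ Z [set j] setT) => //; apply: sub; exists B.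
Qed.

Variables (x : E) (n : nat).
Hypothesis mx : measurable [set x].

Let horizon := [set t : R | 0 <= t /\ (t%:E < tstar x)%E].

Notation F := (enlarged_filtration Z S n).
Notation D i := (visit Z x i).

Let mvisit i : measurable (D i).
Proof. exact: measurable_visit. Qed.

Lemma enlarged_visit i t : (i < n)%N -> F t (D i).
Proof. by move=> in_; apply: sub_sigma_algebra; left; exact: sigma_of_visit. Qed.

Lemma enlarged_survive i v t : (i < n)%N -> 0 <= v -> v <= t -> F t (survive S i v).
Proof.
move=> in_ v0 vt; apply: sub_sigma_algebra; right; exists i => //.
apply: sub_sigma_algebra; exists v; first by rewrite /= v0.
exists [set 0]; first exact: measurable_set1.
apply/seteqP; split => w /=; rewrite /jump /survive /= indicE ltNge.
  move=> [_ h]; apply/negP => Sv; move: h; rewrite mem_set//= => /eqP.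
  by rewrite oner_eq0.
by move=> /negP h; split => //; rewrite memNset.
Qed.

Lemma enlarged_measurable t : F t `<=` measurable.
Proof.
apply: smallest_sub; first exact: sigma_algebra_measurable.
move=> A [/measurable_sigma_of//|[i _]].
move: A; apply: smallest_sub; first exact: sigma_algebra_measurable.
move=> _ [s _ [B mB <-]].
apply: (measurable_indic _ measurableT mB).
rewrite -[X in measurable X]setTI; exact: measurable_lee.
Qed.

Lemma enlarged_filtration_filtration : filtration horizon F.
Proof.
split=> [t _|t _|s t _ _ st]; [exact: smallest_sigma_algebra|exact: enlarged_measurable|].
apply: sub_smallest2r; first exact: smallest_sigma_algebra.
move=> A [ZA|[i iI iA]]; [by left|right; exists i => //].
move: A iA; apply: sub_smallest2r; first exact: smallest_sigma_algebra.
move=> A [u /= /andP[u0 us] uA]; exists u => //=.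
by rewrite u0 (le_trans us).
Qed.

Definition hazard i t w : \bar R :=
  (\int[mu]_(u in `[0%R, t]) (rate_before (rate x) (S i.+1) u w)%:E)%E.

Lemma hazard_ge0 i t w : (0 <= hazard i t w)%E.
Proof.
by apply: integral_ge0 => u _; rewrite lee_fin rate_before_ge0//; exact: rate_ge0.
Qed.

Definition counted i t : set Omega := D i `&` ~` survive S i t.

(** Extended real valued: the hazards can be infinite on a null event. *)
Definition total_hazard t w : \bar R := (\sum_(i < n) (hazard i t \_ (D i)) w)%E.

Lemma compensatedE t w : 0 <= t ->
  compensated Z S lambda n x t w =
  \sum_(i < n) \1_(counted i t) w - fine (total_hazard t w).
Proof.
move=> t0; rewrite /compensated; congr (_ - fine _).
  apply: eq_bigr => i _.
  have -> : [set w | (S i.+1 w <= t%:E)%E] = ~` survive S i t.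
    by apply/seteqP; split => w0 /=; rewrite /survive /= leNgt => /negP.
  by rewrite mulrC /counted indicI.
rewrite /total_hazard.
transitivity (\int[mu]_(s in `[0%R, t])
    \sum_(i < n) (\1_(D i) w * rate_before (rate x) (S i.+1) s w)%:E)%E.
  apply: eq_integral => s; rewrite inE /= in_itv /= => /andP[s0 _].
  rewrite sumEFin /at_risk mulr_sumr; congr EFin; apply: eq_bigr => i _.
  rewrite /rate_before mulrA mulrC; congr (_ * (_ * _)).
  by rewrite /rate patchE mem_set//= in_itv /= s0.
rewrite ge0_integral_sum//; first last.
- by move=> i s _; rewrite lee_fin mulr_ge0// rate_before_ge0//; exact: rate_ge0.
- move=> i; apply/measurable_EFinP; apply: measurable_funM => //.
  apply/measurable_EFinP; apply: measurable_rate_before => //.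
  + exact: measurable_rate.
apply: eq_bigr => i _; rewrite /patch indicE; case: ifPn => wD /=.
  by apply: eq_integral => s _; rewrite mul1r.
by apply: integral0_eq => s _; rewrite mul0r.
Qed.

Lemma enlarged_hazard i t : (i < n)%N -> 0 <= t ->
  measurable_fun (setT : set (g_sigma_algebraType (sigma_of `I_n Z `|`
      \bigcup_(i in `I_n) jump_filtration S i t))) (hazard i t).
Proof.
move=> in_ t0.
apply: (@measurable_integral_rate_before _ _ _ (rate x) (S i.+1) _ _ _ _ (BLeft 0%R) t) => //.
- exact: rate_ge0.
- exact: measurable_rate.
- by move=> b b0 bt; exact: enlarged_survive.
Qed.

Lemma enlarged_total_hazard t : 0 <= t ->
  measurable_fun (setT : set (g_sigma_algebraType (sigma_of `I_n Z `|`
      \bigcup_(i in `I_n) jump_filtration S i t))) (total_hazard t).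
Proof.
move=> t0; apply: emeasurable_sum => i.
apply/(measurable_restrictT _ _).1; first exact: enlarged_visit.
by apply: measurable_funTS; exact: enlarged_hazard.
Qed.

Lemma compensated_adapted t : 0 <= t ->
  preimage_set_system setT (compensated Z S lambda n x t) measurable `<=` F t.
Proof.
move=> t0 _ [B mB <-].
suff mX : measurable_fun (setT : set (g_sigma_algebraType (sigma_of `I_n Z `|`
      \bigcup_(i in `I_n) jump_filtration S i t))) (compensated Z S lambda n x t).
  exact: (mX measurableT B mB).
rewrite (_ : compensated _ _ _ _ _ _ = fun w =>
    \sum_(i < n) \1_(counted i t) w - fine (total_hazard t w)); last first.
  by apply/funext => w; rewrite compensatedE.
apply: measurable_funB.
  apply: measurable_sum => i; apply: measurable_indic.
  apply: measurableI; first exact: enlarged_visit.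
  by apply: measurableC; exact: enlarged_survive.
by apply: (measurableT_comp (fine_measurable measurableT)); exact: enlarged_total_hazard.
Qed.

Lemma hazard_split i s t w : 0 <= s -> s <= t ->
  (hazard i t w = hazard i s w +
     \int[mu]_(u in `]s, t]) (rate_before (rate x) (S i.+1) u w)%:E)%E.
Proof.
move=> s0 st; rewrite /hazard.
rewrite (@itv_bndbnd_setU _ _ (BLeft 0) (BRight s) (BRight t)) ?bnd_simp//.
rewrite ge0_integral_setU//.
- apply: measurable_rate_before => //; first exact: measurable_rate.
  exact: measurableU.
- by move=> u _; rewrite lee_fin rate_before_ge0//; exact: rate_ge0.
- apply/disj_setPS => u /= []; rewrite !in_itv /= => /andP[_ us] /andP[su _].
  by move: us; rewrite leNgt su.
Qed.

Lemma hazard0 i w : hazard i 0 w = 0%E.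
Proof. by rewrite /hazard set_itv1 integral_set1. Qed.

Lemma survival_rate v : horizon v -> survival lambda tstar x v = decay (rate x) v.
Proof. by move=> [_ vt]; rewrite survivalE vt mulr1. Qed.

Lemma horizonW s t : 0 <= s -> s <= t -> horizon t -> horizon s.
Proof. by move=> s0 st [_ tx]; split => //; apply: le_lt_trans tx; rewrite lee_fin. Qed.

Lemma horizon0 : horizon 0.
Proof. by split => //; exact: tstar_gt0. Qed.

Lemma visit_survival i v : (i < n)%N -> horizon v ->
  (P (D i `&` survive S i v) =
   (decay (rate x) v)%:E * P (D i `&` survive S i 0))%E.
Proof.
move=> in_ hv; have v0 := hv.1.
have := @filtration_survival_ratio _ _ _ P _ _ Z S _ S_ge0 survival_ge0
  measurable_survival survival_law x n mx i 0 v setT (lexx _) v0 in_.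
rewrite !setTI (survival_rate horizon0) (survival_rate hv).
rewrite (_ : decay (rate x) 0 = 1) ?mul1e; last first.
  by rewrite /decay /cumul set_itv1 integral_set1 oppe0 expeR0.
apply; exact: (@measurableT _ (g_sigma_algebraType _)).
Qed.

(** [filtration_survival_ratio] provides both laws that [compensator] asks for:
    the one on X at s = 0 and A = setT, and the proportionality on D. *)
Lemma survival_increment i s t A : (i < n)%N -> 0 <= s -> s <= t -> horizon t ->
  F s A ->
  (\int[P]_(w in A `&` D i)
      \int[mu]_(u in `]s, t]) (rate_before (rate x) (S i.+1) u w)%:E +
   P (A `&` D i `&` survive S i t) = P (A `&` D i `&` survive S i s))%E.
Proof.
move=> in_ s0 st ht FA.
have mA := enlarged_measurable FA.
apply: (@compensator _ _ _ P (rate x) (S i.+1) _ _ _ (D i)) => //.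
- exact: rate_ge0.
- exact: measurable_rate.
- by apply: measurableI => //; exact: mvisit.
- by move=> v v0 vt; apply: visit_survival => //; exact: horizonW ht.
- move=> v sv vt.
  have hs := horizonW s0 st ht; have hv := horizonW (le_trans s0 sv) vt ht.
  rewrite -(survival_rate hs) -(survival_rate hv).
  rewrite -!setIA.
  exact: (@filtration_survival_ratio _ _ _ P _ _ Z S _ S_ge0 survival_ge0
    measurable_survival survival_law x n).
Qed.

Lemma measurable_hazard i t : (i < n)%N -> 0 <= t -> measurable_fun setT (hazard i t).
Proof.
move=> in_ t0; apply: (measurable_fun_sub _ (enlarged_hazard in_ t0)).
exact: enlarged_measurable.
Qed.

Lemma hazard_increment i s t A : (i < n)%N -> 0 <= s -> s <= t -> horizon t ->
  F s A ->
  (\int[P]_(w in A `&` D i) hazard i t w + P (A `&` D i `&` survive S i t) =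
   \int[P]_(w in A `&` D i) hazard i s w + P (A `&` D i `&` survive S i s))%E.
Proof.
move=> in_ s0 st ht FA.
have mAD : measurable (A `&` D i).
  by apply: measurableI; [exact: enlarged_measurable FA|exact: mvisit].
transitivity (\int[P]_(w in A `&` D i) hazard i s w +
    (\int[P]_(w in A `&` D i)
       \int[mu]_(u in `]s, t]) (rate_before (rate x) (S i.+1) u w)%:E +
     P (A `&` D i `&` survive S i t)))%E; last first.
  by congr (_ + _)%E; exact: survival_increment.
rewrite [RHS]addeA; congr (_ + _)%E.
under eq_integral => w _ do rewrite (hazard_split _ _ s0 st).
apply: ge0_integralD => //.
- by move=> w _; exact: hazard_ge0.
- by apply: measurable_funTS; exact: measurable_hazard.
- by move=> w _; apply: integral_ge0 => u _; rewrite lee_fin rate_before_ge0//; exact: rate_ge0.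
- apply: measurable_funTS.
  apply: (@measurable_fun_sub _ _ (sigma_of `I_n Z `|`
      \bigcup_(i in `I_n) jump_filtration S i t)); first exact: enlarged_measurable.
  apply: (@measurable_integral_rate_before _ _ _ (rate x) (S i.+1) _ _ _ _ (BRight s) t) => //.
  + exact: rate_ge0.
  + exact: measurable_rate.
  + exact: le_trans st.
  + by move=> b b0 bt; exact: enlarged_survive.
Qed.

(** The expected hazard is at most 1 even if the cumulative rate explodes: it is
    the probability that the jump occurs in ]0, t], by [hazard_increment] from
    time 0. *)
Lemma hazard_lty i t : (i < n)%N -> horizon t ->
  (\int[P]_(w in D i) hazard i t w < +oo)%E.
Proof.
move=> in_ ht.
have FT : F 0 setT by exact: (@measurableT _ (g_sigma_algebraType _)).
have := hazard_increment in_ (lexx 0) ht.1 ht FT; rewrite !setTI.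
rewrite [X in (_ = X + _)%E](_ : _ = 0%E) ?add0e; last first.
  by apply: integral0_eq => w _; exact: hazard0.
move=> h; apply: (@le_lt_trans _ _ (P (D i `&` survive S i 0))); last first.
  rewrite (le_lt_trans (probability_le1 _ _)) ?ltry//.
  by apply: measurableI; [exact: mvisit|exact: measurable_survive].
by rewrite -h leeDl.
Qed.

Lemma integrable_hazard i t : (i < n)%N -> horizon t ->
  P.-integrable setT (hazard i t \_ (D i)).
Proof.
move=> in_ ht; apply: (iffLR (integrable_mkcond _ (mvisit i))).
apply/integrableP; split.
  by apply: measurable_funTS; apply: measurable_hazard => //; exact: ht.1.
under eq_integral do rewrite gee0_abs ?hazard_ge0//.
exact: hazard_lty.
Qed.

Lemma integrable_total_hazard t : horizon t -> P.-integrable setT (total_hazard t).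
Proof.
move=> ht; apply: integrable_sum => // i _.
exact: integrable_hazard.
Qed.

Lemma measurable_counted i t : measurable (counted i t).
Proof.
apply: measurableI; first exact: mvisit.
by apply: measurableC; exact: measurable_survive.
Qed.

Lemma integrable_compensated t : horizon t ->
  P.-integrable setT (EFin \o compensated Z S lambda n x t).
Proof.
move=> ht.
have ihf := integrable_fine (integrable_total_hazard ht).
have : P.-integrable setT
    ((fun w => \sum_(i < n) (\1_(counted i t) w)%:E) \- (EFin \o (fine \o total_hazard t)))%E.
  apply: integrableB => //.
  by apply: integrable_sum => // i _; apply: integrable_indic => //; exact: measurable_counted.
apply: eq_integrable => // w _.
by rewrite /= compensatedE ?EFinB ?sumEFin//; exact: ht.1.
Qed.

Lemma integral_compensated t A : horizon t -> measurable A ->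
  (\int[P]_(w in A) (compensated Z S lambda n x t w)%:E =
   \sum_(i < n) (P (A `&` counted i t) - \int[P]_(w in A `&` D i) hazard i t w))%E.
Proof.
move=> ht mA.
have t0 := ht.1.
have iI i : P.-integrable A (EFin \o \1_(counted i t)).
  by apply: (integrableS _ mA _ (integrable_indic _ (measurable_counted i t))).
transitivity (\int[P]_(w in A) (\sum_(i < n) (\1_(counted i t) w)%:E -
    (fine (total_hazard t w))%:E))%E.
  by apply: eq_integral => w _; rewrite compensatedE// EFinB sumEFin.
rewrite integralB//; first last.
- by apply: (integrableS _ mA _ (integrable_fine (integrable_total_hazard ht))).
- by apply: integrable_sum => // i _; exact: iI.
rewrite integral_fine//; last exact: integrable_total_hazard.
rewrite integral_sum//; last by move=> i; exact: iI.
rewrite integral_sum//; last first.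
  by move=> i; apply: (integrableS _ mA _ (integrable_hazard _ ht)).
rewrite -fin_num_sumeN; last first.
  move=> i _; apply: integrable_fin_num => //.
  by apply: (integrableS _ mA _ (integrable_hazard _ ht)).
rewrite -big_split /=; apply: eq_bigr => i _; congr (_ - _)%E.
  rewrite (integral_indic _ mA); last exact: measurable_counted.
  by congr (P _); exact: setIC.
by rewrite integral_mkcondr.
Qed.

(** For A known at time s, the probability of the jumps that occur in ]s, t] on A
    and the expected increment of the hazard over ]s, t] on A are both the
    decrease of P(A, X, v < T) from v = s to v = t. *)
Lemma compensated_martingale :
  martingale P horizon F (compensated Z S lambda n x).
Proof.
split.
- exact: enlarged_filtration_filtration.
- by move=> t [t0 _]; exact: compensated_adapted.
- by move=> t ht; exact: integrable_compensated.
move=> s t hs ht st; split.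
- by apply: compensated_adapted; exact: hs.1.
- exact: integrable_compensated.
move=> A FA; have mA := enlarged_measurable FA.
rewrite (integral_compensated hs mA) (integral_compensated ht mA); apply: eq_bigr => i _.
have mAD : measurable (A `&` D i) by apply: measurableI => //; exact: mvisit.
have finP B : measurable B -> P B \is a fin_num by move=> mB; exact: fin_num_measure.
have finH r : horizon r -> (\int[P]_(w in A `&` D i) hazard i r w)%E \is a fin_num.
  move=> hr; rewrite ge0_fin_numE; last by apply: integral_ge0 => w _; exact: hazard_ge0.
  apply: le_lt_trans (hazard_lty (ltn_ord i) hr).
  apply: ge0_subset_integral => //.
  - by apply: measurable_funTS; apply: measurable_hazard => //; exact: hr.1.
  - by move=> w _; exact: hazard_ge0.
have split_ r : P (A `&` D i) =
    (P (A `&` counted i r) + P (A `&` D i `&` survive S i r))%E.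
  rewrite -measureU.
  - by rewrite /counted setIA -setIUr setUC setUv setIT.
  - by apply: measurableI => //; exact: measurable_counted.
  - by apply: measurableI => //; exact: measurable_survive.
  - by apply/seteqP; split => w // -[[_ [_ nw]] [_ /nw]].
have h1 := split_ t; rewrite (split_ s) in h1.
have h2 := hazard_increment (ltn_ord i) hs.1 st ht FA.
have f1 r : P (A `&` counted i r) \is a fin_num.
  by apply: finP; apply: measurableI => //; exact: measurable_counted.
have f2 r : P (A `&` D i `&` survive S i r) \is a fin_num.
  by apply: finP; apply: measurableI => //; exact: measurable_survive.
exact: (fin_num_exchange (f1 s) (f1 t) (finH s hs) (finH t ht) (f2 s) (f2 t) h1 h2).
Qed.

End marked_renewal.

(** * The martingale property *)

(** Points of a metric space are closed, and the topology of a subset is initial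
    for the inclusion. *)
Lemma measurable_subset_point (R : realType) (X : metricType R) (A : set X)
  (a0 : A) (y : borelType a0) : measurable [set y].
Proof.
have cy : closed [set set_val (y : A)].
  by apply: accessible_closed_set1; apply: hausdorff_accessible; exact: metric_hausdorff.
have oy : open (~` [set y] : set A).
  have := @initial_continuous A X set_val.
  move=> /continuousP /(_ _ (closed_openC cy)).
  congr open; apply/seteqP; split => z /=; first by apply: contra_not => ->.
  by apply: contra_not; exact: val_inj.
by rewrite -[X in measurable X]setCK; apply: measurableC; apply: sub_sigma_algebra.
Qed.

Theorem theorem3p1 (R : realType)
  (* the state space *)
  (calE : metricType R) (E : set calE)
  (calE_separable : separable calE) (E_open : open E) (e0 : E)
  (* transition kernel, jump rate, deterministic censorship *)
  (Q : R.-pker (borelType e0) ~> (borelType e0))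
  (lambda : borelType e0 -> R -> R)
  (lambda_ge0 : forall z s, 0 <= s -> 0 <= lambda z s)
  (lambda_meas : forall z, measurable_fun (`[0, +oo[ : set R) (lambda z))
  (tstar : borelType e0 -> \bar R)
  (tstar_gt0 : forall z, (0 < tstar z)%E)
  (* the marked renewal process *)
  (d : measure_display) (Omega : measurableType d) (P : probability Omega R)
  (nu0 : probability (borelType e0) R)
  (Z : nat -> {RV P >-> borelType e0})
  (S : nat -> {RV P >-> \bar R})
  (Z_markov : markov_chain Q nu0 Z)
  (dU : measure_display) (U : measurableType dU) (eps : nat -> {RV P >-> U})
  (psi : borelType e0 * U -> borelType e0) (psi_meas : measurable_fun setT psi)
  (eps_iid : iid eps)
  (Z_rec : forall n w, Z n.+1 w = psi (Z n w, eps n w))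
  (dV : measure_display) (V : measurableType dV) (delta : nat -> {RV P >-> V})
  (phi : borelType e0 * V -> \bar R) (phi_meas : measurable_fun setT phi)
  (phi_ge0 : forall p, (0 <= phi p)%E)
  (delta_iid : iid delta)
  (S_0 : forall w, S 0%N w = 0%E)
  (S_rec : forall n w, S n.+1 w = phi (Z n w, delta n w))
  (delta_eps_indep :
     independent P (sigma_of setT delta) (sigma_of setT eps))
  (eps_Z0_indep :
     independent P (sigma_of setT eps) (sigma_of [set 0%N] Z))
  (delta_Z0_indep :
     independent P (sigma_of setT delta) (sigma_of [set 0%N] Z))
  (* the law of the interarrival times *)
  (S_law : forall n (t : R), 0 <= t ->
     cond_probability P <<s sigma_of setT Z `|` sigma_of `I_n.+1 S >>
       [set w | (t%:E < S n.+1 w)%E]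
       (fun w => survival lambda tstar (Z n w) t) /\
     cond_probability P (sigma_of [set n] Z)
       [set w | (t%:E < S n.+1 w)%E]
       (fun w => survival lambda tstar (Z n w) t))
  (* the kernel charges finitely many points *)
  (M : nat) (x : 'I_M -> borelType e0)
  (Q_finite : forall z, Q z (~` range x) = 0%E)
  (k : 'I_M) (n : nat) (n_ge1 : (1 <= n)%N) :
  martingale P [set t : R | 0 <= t /\ (t%:E < tstar (x k))%E]
    (enlarged_filtration Z S n)
    (compensated Z S lambda n (x k)).
Proof.
apply: (compensated_martingale (P := P) lambda_ge0 lambda_meas tstar_gt0) => //.
  by move=> j w; rewrite S_rec.
exact: measurable_subset_point.
Qed.
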